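(* Let $M=\mathbb{R}/\mathbb{Z}$ with its standard flat metric, so that $\mathrm{Vol}(\mathbb{R}/\mathbb{Z})=1$. Let $X_1,\dots,X_N$ be $M$-valued random variables, each with distribution $\mu$, and $\mu_N=N^{-1}\sum_{n=1}^N\delta_{X_n}$. Assume $\mu\ge c\,\mathrm{Vol}$ and $\sum_{1\le m<n\le N}\alpha(X_m,X_n)\le BN$ with constants $c>0$, $B\ge0$. Then \[\sqrt{\mathbb{E}W_2^2(\mu_N,\mu)}\le\sqrt{\frac{2+16B}{3cN}}.\]
   Context: $W_2$ is the quadratic Wasserstein metric with respect to the geodesic (circle) distance $\rho$: $W_2(\mu,\nu)=\inf_\pi\left(\int\rho(x,y)^2\,\mathrm{d}\pi(x,y)\right)^{1/2}$ over couplings $\pi$ of $\mu,\nu$. $\alpha(X,Y)=\sup_{A,B}|\Pr(X\in A,Y\in B)-\Pr(X\in A)\Pr(Y\in B)|$ over Borel sets $A,B$. $\mu\ge c\,\mathrm{Vol}$ means $\mu(A)\ge c\,\mathrm{Vol}(A)$ for all Borel $A$. *)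

(* Defs.v *)
From HB Require Import structures.
From mathcomp Require Import all_boot all_order all_algebra.
From mathcomp Require Import all_classical all_reals all_analysis.
Set Implicit Arguments. Unset Strict Implicit. Unset Printing Implicit Defensive.
Import Order.TTheory GRing.Theory Num.Theory.
Local Open Scope classical_set_scope.
Local Open Scope ring_scope.

(* The circle M = R/Z is represented by the fundamental domain [0,1) of R.
   Points of M are reals in [0,1); Borel sets of M are Borel subsets of [0,1);
   Vol is Lebesgue measure restricted to [0,1) (total mass 1). *)
Definition circ {R : realType} : set R := `[0%R, 1%R[%classic.

(* geodesic (circle) distance between points of [0,1) *)
Definition rho {R : realType} (x y : R) : R := Num.min `|x - y| (1 - `|x - y|).

Definition coupling {R : realType} (mu1 mu2 : set R -> \bar R)
  (pi : probability (R * R)%type R) : Prop :=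
  forall A : set R, measurable A ->
    pi (A `*` setT) = mu1 A /\ pi (setT `*` A) = mu2 A.

Definition W2sq {R : realType} (mu1 mu2 : set R -> \bar R) : \bar R :=
  ereal_inf [set (\int[pi]_z ((rho z.1 z.2) ^+ 2)%:E)%E
            | pi in [set pi | coupling mu1 mu2 pi]].

Definition alpha {d} {T : measurableType d} {R : realType} (P : probability T R)
  (X Y : T -> R) : \bar R :=
  ereal_sup [set v | exists A B : set R, [/\ measurable A, measurable B &
     v = (`| P (X @^-1` A `&` Y @^-1` B) - P (X @^-1` A) * P (Y @^-1` B) |)%E]].

Definition empirical {d} {T : measurableType d} {R : realType} (N : nat)
  (X : 'I_N -> T -> R) (w : T) : set R -> \bar R :=
  fun A => ((N%:R)^-1%:E * \sum_(n < N) \d_(X n w) A)%E.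

(* Main.v *)
(* On the fundamental domain, rho x y <= |x - y|, so W2^2 is at most the squared
   L^2 distance of the quantile functions a of mu and b of mu_N (the coupling is
   the image of the uniform law on [0,1] under s |-> (b s, a s)). Let F and G be
   the distribution functions. At level s, the points y between a s and b s are
   those with s between F y and G y; there mu >= c Vol gives
   |F y - G y| >= c |y - a s|. Integrating |F y - G y| over the region between
   the graphs of F and G, first in y and then in s, bounds it below by
   (c/2) \int (a - b)^2; in the other order it equals \int (F - G)^2. Hence
   W2^2 <= (2/c) \int (F - G)^2. For fixed y, the variance of G y is at most
   (1/4 + 2B)/N, because the covariance of {X_m <= y} and {X_n <= y} is at most
   alpha(X_m, X_n). Altogether E W2^2 <= (1 + 8B)/(2cN) <= (2 + 16B)/(3cN). *)

Require Import Defs.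
From HB Require Import structures.
From mathcomp Require Import all_boot all_order all_algebra.
From mathcomp Require Import all_classical all_reals all_analysis.
From mathcomp Require Import measurable_realfun ring lra.
Set Implicit Arguments.
Unset Strict Implicit.
Unset Printing Implicit Defensive.
Import Order.TTheory GRing.Theory Num.Theory numFieldNormedType.Exports.
Local Open Scope classical_set_scope.
Local Open Scope ring_scope.

(** * Distribution and quantile functions *)

Section distribution_function.
Context {R : realType}.

Definition dfun (p : probability R R) (x : R) : R := fine (p `]-oo, x]%classic).

(* Truncating to [0,1] makes this monotone on all of R: it is 0 for t <= 0 and 1
   for t > 1. *)
Definition quantile (p : probability R R) (t : R) : R :=
  inf [set x | 0 <= x /\ (t <= dfun p x \/ 1 <= x)].

Variable p : probability R R.

Lemma dfunE x : (dfun p x)%:E = p `]-oo, x]%classic.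
Proof. by rewrite fineK ?fin_num_measure. Qed.

Lemma dfun_nondecreasing : nondecreasing_fun (dfun p).
Proof.
move=> x y xy; rewrite -lee_fin !dfunE le_measure ?inE//.
exact: subset_itvl.
Qed.

Lemma dfun_ge0 x : 0 <= dfun p x.
Proof. by rewrite -lee_fin dfunE. Qed.

Lemma dfun_le1 x : dfun p x <= 1.
Proof. by rewrite -lee_fin dfunE probability_le1. Qed.

Lemma measurable_dfun : measurable_fun setT (dfun p).
Proof. exact: (nondecreasing_measurable _ dfun_nondecreasing). Qed.

Lemma dfunB x y : x <= y -> (dfun p y - dfun p x)%:E = p `]x, y]%classic.
Proof.
move=> xy; rewrite EFinB !dfunE.
have -> : `]x, y]%classic = `]-oo, y] `\` `]-oo, x].
  by rewrite -[RHS]setCK setCD setCitvl setUC -[LHS]setCK setCitv.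
rewrite measureD ?setIidr//; first exact: subset_itvl.
by rewrite -ge0_fin_numE// fin_num_measure.
Qed.

Lemma dfun_right_continuous : right_continuous (dfun p).
Proof.
(* [dfun p] is the cdf of the identity, seen as a random variable on the line equipped with [p]. *)
pose idR : R -> R := idfun.
pose h := isMeasurableFun.Build _ _ R R idR (@measurable_id _ _ setT).
pose X : {RV p >-> R} := HB.pack idR h.
move=> a; apply: fine_cvg; rewrite dfunE.
exact: (@cdf_right_continuous _ _ _ p X a).
Qed.

Hypothesis pcirc : p circ = 1%E.

Let measurable_circ : measurable (circ : set R).
Proof. exact: measurable_itv. Qed.

Lemma dfun_lt0 x : x < 0 -> dfun p x = 0.
Proof.
move=> x0; apply/eqP; rewrite -eqe dfunE; apply/eqP.
have pC0 : p (~` circ) = 0%E by rewrite probability_setC// pcirc subee.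
apply: (@subset_measure0 _ _ _ p _ (~` circ)) => //; first exact: measurableC.
move=> y /=; rewrite !in_itv/= => yx; rewrite /circ/= ?in_itv/=.
by apply/negP; rewrite negb_and -ltNge (le_lt_trans yx x0).
Qed.

Lemma dfun_ge1 x : 1 <= x -> dfun p x = 1.
Proof.
move=> x1; apply/eqP; rewrite eq_le dfun_le1 -lee_fin dfunE -pcirc /=.
rewrite le_measure ?inE// => y /=; rewrite !in_itv/= => /andP[_ y1].
by rewrite (ltW (lt_le_trans y1 x1)).
Qed.

Let S t := [set x | 0 <= x /\ (t <= dfun p x \/ 1 <= x)].

Let S1 t : S t 1. Proof. by split; [exact: ler01|right]. Qed.

Let lbS t : lbound (S t) 0. Proof. by move=> x []. Qed.

Lemma quantile_itv t : 0 <= quantile p t <= 1.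
Proof.
apply/andP; split; first by apply: lb_le_inf; [exists 1; exact: S1|exact: lbS].
by apply: inf_lbound; [exists 0; exact: lbS|exact: S1].
Qed.

(** Right continuity of [dfun p] makes the infimum defining the quantile attained. The truncation
    alternative [1 <= x] is harmless for [t <= 1], because [dfun p] equals 1 there. *)
Lemma quantile_le t x : 0 <= x -> t <= 1 ->
  (quantile p t <= x) = (t <= dfun p x).
Proof.
move=> x0 t1; apply/idP/idP => [qx|tx]; last first.
  by apply: inf_lbound; [exists 0; exact: lbS|split=> //; left].
apply: (le_trans _ (dfun_nondecreasing qx)).
apply: (cvgr_to_ge (@dfun_right_continuous (quantile p t))).
near=> y.
have : quantile p t < y by near: y; exact: nbhs_right_gt.
move=> /(inf_lt (ex_intro _ 1 (S1 t)))[z [_ [tz|z1]] zy].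
  exact: le_trans tz (dfun_nondecreasing (ltW zy)).
by rewrite (dfun_ge1 (le_trans z1 (ltW zy))).
Unshelve. all: by end_near. Qed.

Lemma quantile_nondecreasing : nondecreasing_fun (quantile p).
Proof.
move=> s t st; apply: lb_le_inf; first by exists 1; exact: S1.
move=> x [x0 tx]; apply: inf_lbound; first by exists 0; exact: lbS.
by split => //; case: tx => [tx|]; [left; exact: le_trans tx|right].
Qed.

Lemma measurable_quantile : measurable_fun setT (quantile p).
Proof. exact: (nondecreasing_measurable _ quantile_nondecreasing). Qed.

End distribution_function.

(** * The uniform law on [0,1] and its image under a quantile function *)

Section unif.
Context {R : realType}.
Notation U := (uniform_prob (@ltr01 R)).

Lemma integral_unif (f : R -> \bar R) :
  measurable_fun setT f -> (forall x, 0 <= f x)%E ->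
  (\int[U]_x f x = \int[lebesgue_measure]_(x in `[0%R, 1%R]) f x)%E.
Proof. by move=> mf f0; rewrite integral_uniform// subr0 invr1 mul1e. Qed.

Lemma unifE (A : set R) : measurable A ->
  U A = lebesgue_measure (A `&` `[0%R, 1%R]%classic).
Proof.
move=> mA; rewrite /uniform_prob integral_uniform_pdf.
rewrite (eq_integral (cst 1%E)) ?integral_cst ?mul1e//.
  exact: measurableI.
move=> x; rewrite inE/= => -[_]; rewrite in_itv/= => x01.
by rewrite /uniform_pdf x01 subr0 invr1.
Qed.

Lemma unif_itv_le (u v : R) : u <= v -> (U `]u, v]%classic <= (v - u)%:E)%E.
Proof.
move=> uv; rewrite unifE//.
apply: (@le_trans _ _ (lebesgue_measure (`]u, v]%classic : set R))).
  by rewrite le_measure ?inE//; exact: measurableI.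
rewrite lebesgue_measure_itv/= lte_fin; case: ltP => //.
by rewrite lee_fin subr_ge0.
Qed.

Lemma unif_rayE (v : R) : 0 <= v <= 1 -> U `]-oo, v]%classic = v%:E.
Proof.
move=> /andP[v0 v1]; rewrite unifE//.
have -> : `]-oo, v]%classic `&` `[0%R, 1%R]%classic = `[0, v]%classic.
  apply/seteqP; split => x /=; rewrite !in_itv/=.
    by move=> [-> /andP[->]].
  by move=> /andP[-> xv]; rewrite xv (le_trans xv).
rewrite lebesgue_measure_itv/= lte_fin; case: ltP; rewrite ?oppr0 ?adde0//.
by move=> v0'; congr EFin; apply/eqP; rewrite eq_le v0 v0'.
Qed.

(** Closed left rays are stable under intersection, so once they generate the Borel sets, two laws
    on the line can be compared on them alone. *)
Lemma measurable_raysE :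
  @measurable _ R = <<s range (fun x : R => `]-oo, x]%classic) >>.
Proof.
rewrite [LHS](RGenOInfty.measurableE R) eqEsubset; split => A.
  apply: smallest_sub; first exact: smallest_sigma_algebra.
  move=> _ [x ->]; rewrite -setCitvl.
  apply: (@measurableC _
    (g_sigma_algebraType (range (fun x : R => `]-oo, x]%classic)))).
  by apply: sub_sigma_algebra; exists x.
apply: smallest_sub; first exact: smallest_sigma_algebra.
move=> _ [x _ <-].
exact: RGenOInfty.measurable_itv_bounded.
Qed.

(** Inverse transform sampling. On closed left rays with [0 <= x], [quantile_le] turns the preimage,
    within [0,1], into the levels up to [dfun p x]. For [x < 0] both sides vanish, quantiles being
    nonnegative. *)
Lemma unif_quantile (p : probability R R) (A : set R) : p circ = 1%E ->
  measurable A -> U (quantile p @^-1` A) = p A.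
Proof.
move=> pc mA.
pose Q : measurableTypeR R -> R := quantile p.
pose h := isMeasurableFun.Build _ _ _ _ Q (measurable_quantile p).
pose X : {mfun measurableTypeR R >-> R} := HB.pack Q h.
rewrite -[LHS]/(distribution U X A).
apply: (@measure_unique _ R R (range (fun x : R => `]-oo, x]%classic))
  (fun n => `]-oo, n%:R]%classic) _ _ _ _ (distribution U X) p _ _ A mA).
- exact: measurable_raysE.
- move=> _ _ [x _ <-] [y _ <-]; exists (Num.min x y) => //.
  by apply/seteqP; split => z /=; rewrite !in_itv/= le_min => /andP.
- by move=> n; exists n%:R.
- apply/seteqP; split => // x _; exists (Num.truncn x).+1 => //=.
  by rewrite in_itv/= ltW// truncnS_gt.
- move=> _ [x _ <-] /=; rewrite -dfunE.
  have [x0|x0] := ltP x 0.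
    rewrite dfun_lt0// -[RHS](measure0 U); congr (U _).
    apply/seteqP; split => t //=; rewrite in_itv/= => qx.
    have /andP[/le_lt_trans/(_ (le_lt_trans qx x0))] := quantile_itv p t.
    by rewrite ltxx.
  rewrite -unif_rayE ?dfun_ge0 ?dfun_le1// !unifE//; last first.
    by rewrite -[X in measurable X]setTI; exact: measurable_quantile.
  congr (lebesgue_measure _).
  apply/seteqP; split => t /= []; rewrite !in_itv/= => h1 /andP[t0 t1].
    by rewrite t0 t1 -quantile_le.
  by rewrite t0 t1 quantile_le.
- by move=> k; rewrite (le_lt_trans (probability_le1 _ _))// ltry.
Qed.

End unif.

(** * The quantile coupling and its transport cost *)

Section quantile_coupling.
Context {R : realType}.
Notation U := (uniform_prob (@ltr01 R)).
Variables p q : probability R R.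
Hypotheses (pcirc : p circ = 1%E) (qcirc : q circ = 1%E).

Let qpair (t : measurableTypeR R) : R * R := (quantile p t, quantile q t).

Let measurable_qpair : measurable_fun setT qpair.
Proof. by apply: measurable_fun_pair; exact: measurable_quantile. Qed.

(** The interval is closed because a quantile may equal 1. There [1 - |x - y|] is still nonnegative,
    so the minimum may be squared monotonically. *)
Lemma rho_sqr_le (x y : R) : 0 <= x <= 1 -> 0 <= y <= 1 ->
  (rho x y) ^+ 2 <= (x - y) ^+ 2.
Proof.
move=> x01 y01.
have xy1 : `|x - y| <= 1 by rewrite ler_norml; lra.
rewrite -[leRHS]real_normK ?num_real// /rho ler_sqr ?nnegrE ?ge_min ?lexx//.
by rewrite le_min normr_ge0 subr_ge0.
Qed.

Lemma measurable_rho : measurable_fun [set: R * R] (fun z => rho z.1 z.2).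
Proof.
have m : measurable_fun [set: R * R] (fun z : R * R => `|z.1 - z.2|).
  by apply: measurableT_comp => //; exact: measurable_funB.
by apply: measurable_minr => //; exact: measurable_funB.
Qed.

Lemma W2sq_quantile :
  (W2sq p q <= \int[U]_t ((quantile p t - quantile q t) ^+ 2)%:E)%E.
Proof.
pose h := isMeasurableFun.Build _ _ _ _ qpair measurable_qpair.
pose X : {mfun measurableTypeR R >-> (R * R)%type} := HB.pack qpair h.
pose pi : probability (R * R)%type R := distribution U X.
have piC : coupling p q pi.
  move=> A mA; split.
    rewrite -(unif_quantile pcirc mA); congr (U _).
    by apply/seteqP; split=> t /= => [[]|].
  rewrite -(unif_quantile qcirc mA); congr (U _).
  by apply/seteqP; split=> t /= => [[]|].
apply: (@le_trans _ _ (\int[pi]_z ((rho z.1 z.2) ^+ 2)%:E)%E).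
  by apply: ereal_inf_lbound; exists pi.
rewrite ge0_integral_pushforward//; last 2 first.
- apply/measurable_EFinP; apply: measurable_funX; exact: measurable_rho.
- by move=> z _; rewrite lee_fin sqr_ge0.
rewrite preimage_setT; apply: ge0_le_integral => //=.
- by move=> z _; rewrite lee_fin sqr_ge0.
- apply/measurable_EFinP; apply: measurable_funX.
  exact: (measurableT_comp measurable_rho measurable_qpair).
- apply/measurable_EFinP; apply: measurable_funX.
  by apply: measurable_funB; exact: measurable_quantile.
- by move=> t _; rewrite lee_fin rho_sqr_le ?quantile_itv.
Qed.

End quantile_coupling.

(** * Comparison of W2 with the L2 distance of distribution functions *)

Section area.
Context {R : realType}.
Notation U := (uniform_prob (@ltr01 R)).

Lemma integral_affine (k l u v : R) : u <= v ->
  (\int[lebesgue_measure]_(y in `[u, v]) (k * y + l)%:E =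
   (k / 2 * (v ^+ 2 - u ^+ 2) + l * (v - u))%:E)%E.
Proof.
rewrite le_eqVlt => /predU1P[->|uv].
  by rewrite set_itv1 integral_set1 !subrr !mulr0 addr0.
pose F (x : R) := k / 2 * x ^+ 2 + l * x.
have dF (x : R) : is_derive x 1 F (k * x + l).
  apply: is_derive_eq; rewrite /GRing.scale/=.
  by field.
have cF (x : R) : {for x, continuous F}.
  apply: differentiable_continuous; apply/derivable1_diffP.
  exact: (@ex_derive _ _ _ _ _ _ _ (dF x)).
rewrite (@continuous_FTC2 _ (fun y => k * y + l) F)//.
- by rewrite -EFinB; congr EFin; rewrite /F; ring.
- apply: continuous_subspaceT => x.
  by apply: cvgD; [apply: cvgM; [exact: cvg_cst|exact: cvg_id]|exact: cvg_cst].
- split.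
  + by move=> x _; exact: (@ex_derive _ _ _ _ _ _ _ (dF x)).
  + by apply: cvg_at_right_filter; exact: cF.
  + by apply: cvg_at_left_filter; exact: cF.
- by move=> x _; rewrite derive1E; exact: (@derive_val _ _ _ _ _ _ _ (dF x)).
Qed.

(** The integral of [c * |y - a|] between [a] and [b] is the area of a triangle with base [|a - b|]
    and height [c * |a - b|]. *)
Lemma sqr_le_integral_unif (c a b : R) (f : R -> \bar R) :
  0 <= c -> 0 <= a <= 1 -> 0 <= b <= 1 ->
  measurable_fun setT f -> (forall y, 0 <= f y)%E ->
  (forall y, Num.min a b <= y < Num.max a b -> ((c * `|y - a|)%:E <= f y)%E) ->
  ((c / 2 * (a - b) ^+ 2)%:E <= \int[U]_y f y)%E.
Proof.
move=> c0 a01 b01 mf f0 cf; rewrite integral_unif//.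
set u := Num.min a b; set v := Num.max a b.
have uv : u <= v by rewrite /u /v ge_min le_max lexx.
(* As [a] is an endpoint of [[u, v]], the function [c * |y - a|] is affine there, with slope [c] or
   [- c] according to the side. *)
have [k [l [kl klE]]] : exists k l,
   (forall y, u <= y <= v -> k * y + l = c * `|y - a|) /\
   k / 2 * (v ^+ 2 - u ^+ 2) + l * (v - u) = c / 2 * (a - b) ^+ 2.
  rewrite /u /v; case: (leP a b) => ab;
    [exists c, (- c * a)|exists (- c), (c * a)]; split.
  - by move=> y /andP[ay _]; rewrite ger0_norm ?subr_ge0//; ring.
  - by field.
  - by move=> y /andP[_ ya]; rewrite ler0_norm ?subr_le0//; ring.
  - by field.
rewrite -klE -integral_affine//.
have maff (D : set R) : measurable_fun D (fun y : R => (k * y + l)%:E).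
  by apply/measurable_EFinP; apply: measurable_funD.
(* The right endpoint is dropped, since the lower bound on [f] is assumed only for [y < v]. *)
rewrite -integral_itv_bndo_bndc//.
apply: (@le_trans _ _ (\int[lebesgue_measure]_(y in `[u, v[) f y)%E).
  apply: ge0_le_integral => //.
  - move=> y /=; rewrite in_itv/= => /andP[uy /ltW yv].
    by rewrite kl ?uy// lee_fin mulr_ge0.
  - exact: maff.
  - apply: measurable_funTS; exact: mf.
  - move=> y /=; rewrite in_itv/= => uyv; rewrite kl; first exact: cf.
    by case/andP: uyv => -> /ltW.
apply: ge0_subset_integral => //.
  apply: measurable_funTS; exact: mf.
move=> y /=; rewrite !in_itv/= => /andP[uy yv].
apply/andP; split.
  by apply: le_trans uy; rewrite /u le_min; lra.
by apply: (le_trans (ltW yv)); rewrite /v ge_max; lra.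
Qed.

End area.

Section transport_bound.
Context {R : realType}.
Notation U := (uniform_prob (@ltr01 R)).
Variables (mu nu : probability R R) (c : R).
Hypotheses (mucirc : mu circ = 1%E) (nucirc : nu circ = 1%E) (c0 : 0 < c).
Hypothesis mu_ge : forall A : set R, measurable A -> A `<=` circ ->
  (c%:E * lebesgue_measure A <= mu A)%E.

Local Notation F := (dfun mu).
Local Notation G := (dfun nu).

(** The conditions on [x] and [y] keep []x, y]] inside [circ], where [mu_ge] applies. *)
Lemma dfun_growth (x y : R) : 0 <= x -> x <= y -> y < 1 ->
  c * (y - x) <= F y - F x.
Proof.
move=> x0 xy y1; rewrite -lee_fin dfunB//.
apply: le_trans (mu_ge _ _) => //; last first.
  move=> z; rewrite /circ /= !in_itv/= => /andP[xz zy].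
  by rewrite (le_trans x0 (ltW xz)) (le_lt_trans zy).
rewrite lebesgue_measure_itv/= lte_fin EFinM.
by move: xy; rewrite le_eqVlt => /predU1P[->|->//]; rewrite ltxx subrr.
Qed.

(** If [a <= y < b], then [G y < s <= F a], so [F y - G y] exceeds the growth of [F] from [a] to
    [y]. If [b <= y < a], then [F y < s <= G y], and the growth of [F] to the right of [y] is used
    instead. *)
Lemma quantile_gap (s y : R) : s <= 1 ->
  let a := quantile mu s in let b := quantile nu s in
  Num.min a b <= y < Num.max a b ->
  Num.min (F y) (G y) < s <= Num.max (F y) (G y) /\
  c * `|y - a| <= `|F y - G y|.
Proof.
move=> s1 /=; set a := quantile mu s; set b := quantile nu s.
have /andP[a0 a1] : 0 <= a <= 1 := quantile_itv mu s.
have /andP[b0 b1] : 0 <= b <= 1 := quantile_itv nu s.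
have aF x : 0 <= x -> (a <= x) = (s <= F x) by move=> x0; exact: quantile_le.
have bG x : 0 <= x -> (b <= x) = (s <= G x) by move=> x0; exact: quantile_le.
rewrite gt_min le_max lt_max ge_min => /andP[mab Mab].
have [ab|ba] := leP a b.
  have ay : a <= y by case/orP: mab => // /(le_trans ab).
  have yb : y < b by case/orP: Mab => // /lt_le_trans; apply.
  have y0 := le_trans a0 ay.
  have sF : s <= F y by rewrite -aF.
  have sG : G y < s by rewrite ltNge -bG// -ltNge.
  rewrite sF sG orbT; split => //.
  rewrite (@ger0_norm _ (y - a)) ?subr_ge0// ger0_norm; last lra.
  have := dfun_growth a0 ay (lt_le_trans yb b1).
  have : s <= F a by rewrite -aF.
  lra.
have {mab} yb : b <= y by case/orP: mab => // /(le_trans (ltW ba)).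
have {Mab} ya : y < a by case/orP: Mab => // /lt_trans; apply.
have y0 := le_trans b0 yb.
have sG : s <= G y by rewrite -bG.
have sF : F y < s by rewrite ltNge -aF// -ltNge.
rewrite sF sG orbT; split => //.
rewrite (@ltr0_norm _ (y - a)) ?subr_lt0// ltr0_norm; last lra.
(* [F] may jump at [a], so growth is used only up to points [z < a], where [F z < s <= G y]. If the
   bound failed, [y + r] would lie below [a], and at the midpoint [z] of the two [F] would have
   grown by more than [G y - F y]. *)
rewrite !opprB leNgt; apply/negP => gap.
pose r := (G y - F y) / c.
have rE : c * r = G y - F y by rewrite /r mulrC divfK// gt_eqF.
have r0 : 0 <= r by rewrite divr_ge0// ?ltW//; lra.
have ra : r < a - y by rewrite -(ltr_pM2l c0) rE.
pose z := y + (r + (a - y)) / 2.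
have yz : y <= z by rewrite /z; lra.
have za : z < a by rewrite /z; lra.
have := dfun_growth y0 yz (lt_le_trans za a1).
have : F z < s by rewrite ltNge -aF ?(le_trans y0)// -ltNge.
rewrite /z addrAC subrr add0r => Fzs.
have -> : c * ((r + (a - y)) / 2) = (c * r + c * (a - y)) / 2 by ring.
rewrite rE; lra.
Qed.

(** The weight [|F - G|] on the region between the two graphs. The first coordinate is the level
    [s], the second the position [y]. *)
Let h (z : measurableTypeR R * measurableTypeR R) : \bar R :=
  (`|F z.2 - G z.2| *
   (Num.min (F z.2) (G z.2) < (z.1 : R) <= Num.max (F z.2) (G z.2))%R%:R)%:E.

Let h0 z : (0 <= h z)%E.
Proof. by rewrite lee_fin mulr_ge0. Qed.

Let mh : measurable_fun setT h.
Proof.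
have mF : measurable_fun setT
    (fun z : measurableTypeR R * measurableTypeR R => F z.2).
  exact: measurableT_comp (measurable_dfun _) measurable_snd.
have mG : measurable_fun setT
    (fun z : measurableTypeR R * measurableTypeR R => G z.2).
  exact: measurableT_comp (measurable_dfun _) measurable_snd.
have m1 : measurable_fun setT
    (fun z : measurableTypeR R * measurableTypeR R => z.1 : R).
  exact: measurable_fst.
apply/measurable_EFinP; apply: measurable_funM.
  by apply: measurableT_comp => //; exact: measurable_funB.
apply: (measurableT_comp (f := fun b : bool => b%:R : R)) => //.
apply: measurable_and.
  by apply: measurable_fun_ltr => //; exact: measurable_minr.
by apply: measurable_fun_ler => //; exact: measurable_maxr.
Qed.

(** At a fixed position the levels fill an interval of length [|F y - G y|], and the weight
    contributes the second factor. *)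
Let int_h_le y : (\int[U]_s h (s, y) <= ((F y - G y) ^+ 2)%:E)%E.
Proof.
rewrite /h/=; set m := Num.min _ _; set M := Num.max _ _.
have mM : m <= M by rewrite /m /M ge_min le_max lexx.
have MmE : M - m = `|F y - G y|.
  rewrite /M /m; case: (leP (F y) (G y)) => FG.
    by rewrite ler0_norm ?subr_le0// opprB.
  by rewrite gtr0_norm ?subr_gt0.
under eq_integral => s _.
  rewrite (_ : (m < s <= M) = (s \in `]m, M]%classic)); last first.
    by rewrite mem_setE in_itv.
  rewrite -indicE EFinM; over.
rewrite ge0_integralZl//; last first.
  exact/measurable_EFinP/measurable_indic.
rewrite integral_indic// setIT -[leRHS]/((_ ^+ 2)%:E).
rewrite -real_normK ?num_real// expr2 EFinM; apply: lee_pmul => //.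
by rewrite -MmE unif_itv_le.
Qed.

Lemma W2sq_le_dfun :
  ((c / 2)%:E * W2sq nu mu <= \int[U]_y ((F y - G y) ^+ 2)%:E)%E.
Proof.
pose g (s : measurableTypeR R) : R := quantile nu s - quantile mu s.
have mg : measurable_fun setT g.
  by apply: measurable_funB; exact: measurable_quantile.
have mg2 : measurable_fun setT (fun s => (g s ^+ 2)%:E).
  by apply/measurable_EFinP; exact: measurable_funX.
apply: (@le_trans _ _ ((c / 2)%:E * \int[U]_s (g s ^+ 2)%:E)%E).
  by apply: lee_wpmul2l; [rewrite lee_fin divr_ge0// ltW|exact: W2sq_quantile].
have c20 : (0 <= (c / 2)%:E)%E by rewrite lee_fin divr_ge0// ltW.
rewrite -ge0_integralZl//; last by move=> s _; rewrite lee_fin sqr_ge0.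
(* The double integral of [h] separates the two sides: the upper bound integrates first in [s], the
   lower bound first in [y]. *)
apply: (@le_trans _ _ (\int[U]_s \int[U]_y h (s, y))%E); last first.
  rewrite (fubini_tonelli (m1 := U) (m2 := U) h)//.
  apply: ge0_le_integral => //.
  - by move=> y _; exact: integral_ge0.
  - exact: measurable_fun_fubini_tonelli_G.
  - apply/measurable_EFinP; apply: measurable_funX.
    by apply: measurable_funB; exact: measurable_dfun.
have mL : measurable_fun setT (fun s : R => ((c / 2)%:E * (g s ^+ 2)%:E)%E).
  exact: emeasurable_funM.
have L0 (s : R) : (0 <= (c / 2)%:E * (g s ^+ 2)%:E)%E.
  by rewrite mule_ge0// lee_fin sqr_ge0.
have mI : measurable_fun setT (fun s : R => \int[U]_y h (s, y))%E.
  exact: (measurable_fun_fubini_tonelli_F (m2 := U)).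
have I0 (s : R) : (0 <= \int[U]_y h (s, y))%E by exact: integral_ge0.
(* Passing to Lebesgue measure on [0,1] makes [s <= 1] available for [quantile_gap]. *)
rewrite [leLHS](integral_unif mL L0) [leRHS](integral_unif mI I0).
apply: ge0_le_integral => //.
- by apply: measurable_funTS; exact: mL.
- by apply: measurable_funTS; exact: mI.
- move=> s /=; rewrite in_itv/= => /andP[s0 s1].
  rewrite -EFinM /g -sqrrN opprB.
  apply: sqr_le_integral_unif; rewrite ?quantile_itv ?ltW//.
  + exact: measurableT_comp mh (measurable_pair1 _).
  + move=> y /(quantile_gap s1)[E ?].
    by rewrite /h/= E mulr1 lee_fin.
Qed.

End transport_bound.

(** * Mean square deviation of the empirical distribution function *)

(** Applied to a covariance matrix, this separates the variances from the pairs [m < n] that the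
    mixing hypothesis controls. *)
Lemma sum_symmetric (R : nzRingType) (N : nat) (f : 'I_N -> 'I_N -> R) :
  (forall m n, f m n = f n m) ->
  \sum_(m < N) \sum_(n < N) f m n =
  \sum_(m < N) f m m + 2 * \sum_(m < N) \sum_(n < N | (m < n)%N) f m n.
Proof.
move=> fC.
have -> : \sum_(m < N) \sum_(n < N) f m n = \sum_(m < N) f m m +
    \sum_(m < N) \sum_(n < N | (m < n)%N) f m n +
    \sum_(m < N) \sum_(n < N | (n < m)%N) f m n.
  rewrite -!big_split/=; apply: eq_bigr => m _.
  rewrite (bigD1 m)//= -addrA; congr (_ + _).
  rewrite (bigID (fun n : 'I_N => (m < n)%N))/=.
  by congr (_ + _); apply: eq_bigl => n; rewrite -val_eqE/=; case: ltngtP.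
rewrite -addrA mulr_natl mulr2n; congr (_ + (_ + _)).
rewrite (exchange_big_dep xpredT)//=; apply: eq_bigr => m _; exact: eq_bigr.
Qed.

Section mean_square_deviation.
Context {d : measure_display} {T : measurableType d} {R : realType}.
Variables (P : probability T R) (N : nat) (A : 'I_N -> set T) (p : R).
Hypotheses (N0 : (0 < N)%N) (mA : forall n, measurable (A n)).
Hypothesis PA : forall n, P (A n) = p%:E.

Let q m n := fine (P (A m `&` A n)).

Let qE m n : (q m n)%:E = P (A m `&` A n).
Proof. by rewrite fineK// fin_num_measure//; exact: measurableI. Qed.

(** When [A n] is the event that the [n]-th variable is at most [y], this is the empirical
    distribution function at [y], with mean [p]. *)
Let S (w : T) : R := (N%:R)^-1 * \sum_(n < N) \1_(A n) w.

Let Nn0 : N%:R != 0 :> R.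
Proof. by rewrite pnatr_eq0 -lt0n. Qed.

Let p0 : 0 <= p.
Proof. by rewrite -lee_fin -(PA (Ordinal N0)). Qed.

Let S0 w : 0 <= S w.
Proof. by rewrite /S mulr_ge0 ?invr_ge0// sumr_ge0. Qed.

Let mS : measurable_fun setT S.
Proof.
apply: measurable_funM => //; apply: measurable_sum => n.
exact: measurable_indic.
Qed.

Let integral_S : (\int[P]_w (S w)%:E = p%:E)%E.
Proof.
have mI n : measurable_fun setT (fun w => (\1_(A n) w)%:E : \bar R).
  exact/measurable_EFinP/measurable_indic.
under eq_integral do rewrite /S EFinM -sumEFin.
rewrite ge0_integralZl//.
- rewrite ge0_integral_sum//.
  rewrite (eq_bigr (fun=> p%:E)); last first.
    by move=> n _; rewrite integral_indic// setIT; exact: PA.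
  by rewrite sumEFin -EFinM sumr_const card_ord -[X in _ * X]mulr_natl mulKf.
- exact: emeasurable_sum.
- by move=> w _; apply: sume_ge0 => n _; rewrite lee_fin.
Qed.

Let integral_S2 : (\int[P]_w ((S w) ^+ 2)%:E =
  ((N%:R)^-2 * \sum_(m < N) \sum_(n < N) q m n)%:E)%E.
Proof.
have SE w : ((S w) ^+ 2)%:E =
    (((N%:R)^-2)%:E * \sum_(m < N) \sum_(n < N) (\1_(A m `&` A n) w)%:E)%E.
  rewrite /S exprMn exprVn EFinM; congr (_ * _)%E.
  rewrite expr2 mulr_suml -sumEFin; apply: eq_bigr => m _.
  rewrite mulr_sumr -sumEFin; apply: eq_bigr => n _.
  by rewrite indicI.
under eq_integral do rewrite SE.
have mI m n : measurable_fun setT (fun w => (\1_(A m `&` A n) w)%:E : \bar R).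
  by apply/measurable_EFinP/measurable_indic/measurableI.
rewrite ge0_integralZl//.
- rewrite ge0_integral_sum//.
  + rewrite EFinM; congr (_ * _)%E; rewrite -sumEFin; apply: eq_bigr => m _.
    rewrite ge0_integral_sum//.
    rewrite -sumEFin; apply: eq_bigr => n _.
    by rewrite integral_indic ?setIT ?qE//; exact: measurableI.
  + by move=> m; apply: emeasurable_sum.
  + by move=> m w _; apply: sume_ge0 => n _; rewrite lee_fin.
- by apply: emeasurable_sum => m; apply: emeasurable_sum.
- move=> w _; apply: sume_ge0 => m _; apply: sume_ge0 => n _.
  by rewrite lee_fin.
Qed.

Lemma integral_sqr_dev :
  (\int[P]_w ((p - S w) ^+ 2)%:E =
   ((N%:R)^-2 * (\sum_(m < N) \sum_(n < N) (q m n - p ^+ 2)))%:E)%E.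
Proof.
have mD : measurable_fun setT (fun w => ((p - S w) ^+ 2)%:E).
  by apply/measurable_EFinP/measurable_funX/measurable_funB.
(* The square is expanded with the cross term moved to the left, so that every integrand is
   nonnegative. *)
have H : (\int[P]_w ((p - S w) ^+ 2)%:E + (2 * p)%:E * \int[P]_w (S w)%:E =
    \int[P]_w (p ^+ 2)%:E + \int[P]_w ((S w) ^+ 2)%:E)%E.
  rewrite -ge0_integralZl//; last 3 first.
  - exact/measurable_EFinP.
  - by move=> w _; rewrite lee_fin.
  - by rewrite lee_fin mulr_ge0.
  rewrite -!ge0_integralD//.
  - by apply: eq_integral => w _; rewrite -EFinM -!EFinD; congr EFin; ring.
  - by move=> w _; rewrite lee_fin sqr_ge0.
  - by move=> w _; rewrite lee_fin sqr_ge0.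
  - exact/measurable_EFinP/measurable_funX.
  - by move=> w _; rewrite lee_fin sqr_ge0.
  - move=> w _; apply: mule_ge0; rewrite lee_fin; last exact: S0.
    exact: mulr_ge0.
  - by apply: emeasurable_funM => //; exact/measurable_EFinP.
have qp : \sum_(m < N) \sum_(n < N) (q m n - p ^+ 2) =
    \sum_(m < N) \sum_(n < N) q m n - N%:R ^+ 2 * p ^+ 2.
  under eq_bigr do rewrite sumrB sumr_const card_ord -mulr_natl.
  by rewrite sumrB sumr_const card_ord -mulr_natl; ring.
have cE : (\int[P]_w (p ^+ 2)%:E = (p ^+ 2)%:E)%E.
  rewrite integral_cst// -[RHS]mule1; congr (_ * _)%E.
  exact: probability_setT.
move: H; rewrite integral_S integral_S2 cE.
(* An infinite value is excluded because the other terms of the identity are finite. *)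
case: (\int[P]_w _)%E => [r [rE]| |]//; congr EFin.
rewrite qp mulrBr mulKf ?expf_neq0//.
lra.
Qed.

Lemma integral_sqr_dev_le (B : R) :
  (\sum_(m < N) \sum_(n < N | (m < n)%N)
     `|P (A m `&` A n) - P (A m) * P (A n)| <= (B * N%:R)%:E)%E ->
  (\int[P]_w ((p - S w) ^+ 2)%:E <= ((1 / 4 + 2 * B) / N%:R)%:E)%E.
Proof.
move=> AB.
have {AB} qB :
    \sum_(m < N) \sum_(n < N | (m < n)%N) (q m n - p ^+ 2) <= B * N%:R.
  rewrite -lee_fin (le_trans _ AB)// -sumEFin; apply: lee_sum => m _.
  rewrite -sumEFin; apply: lee_sum => n _.
  by rewrite !PA -qE -EFinM -EFinB lee_fin ler_norm.
(* The variance of an indicator is [p - p ^+ 2], which is largest at [p = 1 / 2]. *)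
have pq m : q m m - p ^+ 2 <= 1 / 4.
  have -> : q m m = p by rewrite /q setIid PA.
  have := sqr_ge0 (p - 1 / 2); nra.
rewrite integral_sqr_dev lee_fin sum_symmetric; last first.
  by move=> m n; rewrite /q setIC.
have NE : (N%:R)^-2 * ((1 / 4) * N%:R + 2 * (B * N%:R)) =
    (1 / 4 + 2 * B) / N%:R :> R by field.
rewrite -NE ler_wpM2l ?invr_ge0 ?exprn_ge0// lerD ?ler_wpM2l//.
rewrite (le_trans (ler_sum _ (fun m _ => pq m)))//.
by rewrite sumr_const card_ord mulr_natr.
Qed.
End mean_square_deviation.

(** * Empirical measures and the final estimate *)

Lemma empirical_is_probability d (T : measurableType d) (R : realType) (N : nat)
  (X : 'I_N -> T -> R) (w : T) : (0 < N)%N ->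
  exists nu : probability R R, empirical X w = nu.
Proof.
move=> N0.
have N1 : 0 <= (N%:R)^-1 :> R by rewrite invr_ge0.
pose r : {nonneg R} := NngNum N1.
(* [msum] is indexed by natural numbers; [insubd] returns them to ['I_N], and its default value
   never occurs below [N]. *)
pose m : {measure set R -> \bar R} :=
  mscale r (msum (fun k => \d_(X (insubd (Ordinal N0) k) w)) N).
have mE A : m A = empirical X w A.
  rewrite /m/= /mscale/= /msum /empirical; congr (_ * _)%E.
  by apply: eq_bigr => k _; rewrite valKd.
have m1 : m setT = 1%E.
  rewrite mE /empirical; under eq_bigr do rewrite diracT.
  by rewrite sumEFin -EFinM sumr_const card_ord mulVf// pnatr_eq0 -lt0n.
pose h := @Measure_isProbability.Build _ _ _ m m1.
pose nu : probability R R := HB.pack (Measure.sort m) h.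
by exists nu; apply/funext => A; rewrite -mE.
Qed.

(* Unlike in [ge0_le_integral], measurability is not assumed: whether [W2sq] is
   measurable in the sample point is not needed, the integral being a supremum
   over simple minorants. *)
Lemma ge0_le_integralT d (T : measurableType d) (R : realType)
  (mu : {measure set T -> \bar R}) (f g : T -> \bar R) :
  (forall x, 0 <= f x)%E -> (forall x, f x <= g x)%E ->
  (\int[mu]_x f x <= \int[mu]_x g x)%E.
Proof.
move=> f0 fg; have g0 x : (0 <= g x)%E by exact: le_trans (fg x).
rewrite !ge0_integralTE//; apply: le_ereal_sup => _ [k kf <-].
by exists k => // x; exact: le_trans (kf x) (fg x).
Qed.

Lemma W2sq_ge0 (R : realType) (mu1 mu2 : set R -> \bar R) :
  (0 <= W2sq mu1 mu2)%E.
Proof.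
apply: le_ereal_inf_tmp => _ [pi _ <-]; apply: integral_ge0 => z _.
by rewrite lee_fin sqr_ge0.
Qed.

Theorem theorem3 (R : realType) (d : measure_display) (T : measurableType d)
  (P : probability T R) (N : nat) (X : 'I_N -> {RV P >-> R})
  (mu : probability R R) (c B : R) :
  (0 < N)%N -> 0 < c -> 0 <= B ->
  (forall n w, X n w \in (circ : set R)) ->
  (forall n (A : set R), measurable A -> P (X n @^-1` A) = mu A) ->
  (forall A : set R, measurable A -> A `<=` circ ->
     ((c%:E * lebesgue_measure A) <= mu A)%E) ->
  (\sum_(m < N) \sum_(n < N | (m < n)%N) alpha P (X m) (X n) <= (B * N%:R)%:E)%E ->
  let E := (\int[P]_w W2sq (empirical (fun n => (X n : T -> R)) w) mu)%E in
  E \is a fin_num /\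
  Num.sqrt (fine E) <= Num.sqrt ((2 + 16 * B) / (3 * c * N%:R)).
Proof.
move=> N0 c0 B0 Xcirc Xmu mu_ge XB E.
pose U := uniform_prob (@ltr01 R).
have mcirc : measurable (circ : set R) by exact: measurable_itv.
have mucirc : mu circ = 1%E.
  rewrite -(Xmu (Ordinal N0))// -(@probability_setT _ _ _ P); congr (P _).
  apply/seteqP; split => // w _ /=.
  by have := Xcirc (Ordinal N0) w; rewrite inE.
pose A (y : R) n := X n @^-1` `]-oo, y]%classic.
pose S (y : R) w : R := (N%:R)^-1 * \sum_(n < N) \1_(A y n) w.
have mA y n : measurable (A y n).
  by rewrite -[X in measurable X]setTI; exact: measurable_funP.
pose V w := (\int[U]_y ((dfun mu y - S y w) ^+ 2)%:E)%E.
(* The transport bound is applied at each sample point, with [S y w] as the distribution function of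
   the empirical measure. *)
have W2V w : (W2sq (empirical (fun n => (X n : T -> R)) w) mu <=
    (2 / c)%:E * V w)%E.
  have [nu nuE] := empirical_is_probability (fun n => (X n : T -> R)) w N0.
  have nucirc : nu circ = 1%E.
    rewrite -nuE /empirical (eq_bigr (fun=> 1%E)); last first.
      by move=> n _; rewrite diracE (Xcirc n w).
    by rewrite sumEFin -EFinM sumr_const card_ord mulVf// pnatr_eq0 -lt0n.
  have SE y : dfun nu y = S y w.
    rewrite /dfun -nuE /empirical /S.
    by rewrite sumEFin -EFinM.
  rewrite nuE /V; under eq_integral do rewrite -SE.
  have := W2sq_le_dfun mucirc nucirc c0 mu_ge.
  move=> /(lee_wpmul2l (_ : (0 <= (2 / c)%:E)%E)).
  rewrite muleA -EFinM (_ : 2 / c * (c / 2) = 1) ?mul1e; last first.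
    by field; rewrite gt_eqF.
  by apply; rewrite lee_fin divr_ge0// ltW.
have mdev : measurable_fun [set: T * measurableTypeR R]
    (fun z => ((dfun mu z.2 - S z.2 z.1) ^+ 2)%:E).
  apply/measurable_EFinP; apply: measurable_funX; apply: measurable_funB.
    exact: measurableT_comp (measurable_dfun _) measurable_snd.
  apply: measurable_funM => //; apply: measurable_sum => n.
  (* Tonelli requires joint measurability in the sample point and [y]; written as a comparison of
     two measurable functions, the indicator has it. *)
  rewrite (_ : (fun z => _) = fun z => (X n z.1 <= (z.2 : R))%R%:R); last first.
    by apply/funext => z; rewrite indicE /A; congr (_%:R); rewrite mem_setE.
  apply: (measurableT_comp (f := fun b : bool => b%:R : R)) => //.
  apply: measurable_fun_ler; last exact: measurable_snd.
  by apply: measurableT_comp => //; exact: measurable_fst.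
have dev0 z : (0 <= ((dfun mu z.2 - S z.2 z.1) ^+ 2)%:E)%E.
  by rewrite lee_fin sqr_ge0.
have VB : (\int[P]_w V w <= ((1 / 4 + 2 * B) / N%:R)%:E)%E.
  rewrite /V (fubini_tonelli (m1 := P) (m2 := U) _ mdev dev0).
  apply: (@le_trans _ _ (\int[U]_y ((1 / 4 + 2 * B) / N%:R)%:E)%E).
    apply: ge0_le_integralT => y; first exact: integral_ge0.
    rewrite /= /S.
    apply: (integral_sqr_dev_le (A := A y) (p := dfun mu y)) => //.
      by move=> n; rewrite dfunE; exact: Xmu.
    apply: le_trans XB; apply: lee_sum => m _; apply: lee_sum => n _.
    (* Taking the same ray for both variables exhibits the covariance of the two events as one of
       the values under the supremum [alpha]. *)
    apply: ereal_sup_ubound; exists `]-oo, y]%classic, `]-oo, y]%classic.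
    by split => //; exact: measurable_itv.
  rewrite integral_cst// -[leRHS]mule1; apply: lee_wpmul2l.
    by rewrite lee_fin divr_ge0// addr_ge0// mulr_ge0.
  exact: probability_le1.
have E0 : (0 <= E)%E by apply: integral_ge0 => w _; exact: W2sq_ge0.
have EB : (E <= ((2 + 16 * B) / (3 * c * N%:R))%:E)%E.
  apply: (@le_trans _ _ (\int[P]_w ((2 / c)%:E * V w))%E).
    by apply: ge0_le_integralT => // w; exact: W2sq_ge0.
  rewrite ge0_integralZl//; last 3 first.
  - exact: (measurable_fun_fubini_tonelli_F (m2 := U) _ mdev).
  - by move=> w _; apply: integral_ge0 => y _; rewrite lee_fin sqr_ge0.
  - by rewrite lee_fin divr_ge0// ltW.
  apply: (@le_trans _ _ ((2 / c)%:E * ((1 / 4 + 2 * B) / N%:R)%:E)%E).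
    by apply: lee_wpmul2l; rewrite // lee_fin divr_ge0// ltW.
  rewrite -EFinM lee_fin.
  (* Over the denominator of the claim, the numerator obtained is three quarters of [2 + 16 * B]. *)
  have -> : 2 / c * ((1 / 4 + 2 * B) / N%:R) =
      (3 / 2 + 12 * B) / (3 * c * N%:R).
    by field; rewrite pnatr_eq0 -lt0n N0 gt_eqF.
  apply: ler_wpM2r; last by lra.
  by rewrite invr_ge0 !mulr_ge0// ltW.
have Efin : E \is a fin_num.
  by rewrite ge0_fin_numE// (le_lt_trans EB)// ltry.
split => //; rewrite ler_sqrt.
  by rewrite -lee_fin fineK.
by rewrite divr_ge0 ?addr_ge0 ?mulr_ge0// ltW.
Qed.
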